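(* Let $\mathcal{H}$ be a finite-dimensional complex Hilbert space and let $\mathcal{A}_0, \mathcal{A}_1 \subseteq \mathbf{D}(\mathcal{H})$ be closed convex sets of density operators. Then there exist positive semidefinite operators $E_0, E_1$ on $\mathcal{H}$ with $E_0 + E_1 = I$ such that the following holds. For every pair $\rho_0 \in \mathcal{A}_0$ and $\rho_1 \in \mathcal{A}_1$, if $\rho$ is chosen uniformly at random from $\{\rho_0, \rho_1\}$ and measured via the measurement $\{E_0, E_1\}$ (outcome $j$ occurring with probability $\operatorname{tr}(E_j \rho)$, outcome $j$ being interpreted as the guess ''$\rho \in \mathcal{A}_j$''), the measurement correctly determines whether $\rho \in \mathcal{A}_0$ or $\rho \in \mathcal{A}_1$ with probability at least $\frac{1}{2} + \frac{1}{4}\operatorname{dist}(\mathcal{A}_0, \mathcal{A}_1)$; that is, $\frac{1}{2}\operatorname{tr}(E_0\rho_0) + \frac{1}{2}\operatorname{tr}(E_1\rho_1) \geq \frac{1}{2} + \frac{1}{4}\operatorname{dist}(\mathcal{A}_0,\mathcal{A}_1)$.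
   Context: $\mathbf{D}(\mathcal{H})$ denotes the set of density operators (positive semidefinite, trace one) on $\mathcal{H}$. The trace norm is $\|A\|_{\mathrm{tr}} = \operatorname{tr}\sqrt{A^\dagger A}$. For closed sets $\mathcal{A}_0, \mathcal{A}_1 \subseteq \mathbf{D}(\mathcal{H})$, $\operatorname{dist}(\mathcal{A}_0,\mathcal{A}_1) = \min\{\|\rho_0 - \rho_1\|_{\mathrm{tr}} : \rho_0 \in \mathcal{A}_0, \rho_1 \in \mathcal{A}_1\}$. *)

(* Defs.v *)
From HB Require Import structures.
From mathcomp Require Import all_boot all_order all_algebra.
From mathcomp Require Import sesquilinear spectral complex.
From mathcomp Require Import all_classical all_reals all_analysis.

Set Implicit Arguments.
Unset Strict Implicit.
Unset Printing Implicit Defensive.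

Import Order.TTheory GRing.Theory Num.Theory.
Import numFieldNormedType.Exports.

Local Open Scope classical_set_scope.
Local Open Scope ring_scope.
Local Open Scope complex_scope.
Local Open Scope sesquilinear_scope.

(* The complex numbers over R.  The bare type R[i] carries no topology, but any
   numFieldType does (the one of its norm), and it lifts entrywise to matrices;
   hence the cast.  In the order of this field, x <= y means that y - x is a
   nonnegative real number. *)
Definition Cx (R : realType) : numClosedFieldType := R[i].

Definition toCx (R : realType) (x : R) : Cx R := x%:C.

(* H is C^n with its standard inner product; operators are n x n matrices and
   the adjoint is the conjugate transpose A ^t*. *)
Definition psdmx (R : realType) (n : nat) (A : 'M[Cx R]_n) : Prop :=
  A \is hermsymmx /\ forall v : 'cV[Cx R]_n, 0 <= (v ^t* *m A *m v) 0 0.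

Definition density (R : realType) (n : nat) : set 'M[Cx R]_n :=
  [set rho | psdmx rho /\ \tr rho = 1].

(* Functional calculus: if A = U^-1 diag(d) U with U unitary, then
   sqrtmx A = U^-1 diag(sqrt d) U.  See sqrtmxP and sqrtmx_unique. *)
Definition sqrtmx (R : realType) (n : nat) (A : 'M[Cx R]_n) : 'M[Cx R]_n :=
  invmx (spectralmx A) *m diag_mx (map_mx sqrtC (spectral_diag A))
    *m spectralmx A.

(* The trace is a nonnegative real (trnormE); Re only changes its type. *)
Definition trnorm (R : realType) (n : nat) (A : 'M[Cx R]_n) : R :=
  complex.Re (\tr (sqrtmx (A ^t* *m A))).

(* For nonempty closed sets of density operators the infimum is a minimum, by
   compactness.  If one of the sets is empty the value is inf set0 = 0. *)
Definition trdist (R : realType) (n : nat) (A0 A1 : set 'M[Cx R]_n) : R :=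
  inf [set trnorm (rho0 - rho1) | rho0 in A0 & rho1 in A1].

Lemma adjmxM (R : realType) (m p q : nat) (A : 'M[Cx R]_(m, p)) (B : 'M[Cx R]_(p, q)) :
  (A *m B) ^t* = B ^t* *m A ^t*.
Proof. by rewrite trmx_mul map_mxM. Qed.

Section facts.
Variables (R : realType) (n : nat).
Implicit Types A B P : 'M[Cx R]_n.

Lemma hermE A : (A \is hermsymmx) = (A == A ^t*).
Proof. by rewrite is_hermitianmxE expr0 scale1r. Qed.

Lemma form_diag (d : 'rV[Cx R]_n) (v : 'cV[Cx R]_n) :
  (v ^t* *m diag_mx d *m v) 0 0 = \sum_i d 0 i * `|v i 0| ^+ 2.
Proof.
rewrite mxE; apply: eq_bigr => i _; rewrite mul_mx_diag !mxE normCK.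
by rewrite mulrAC mulrC [v i 0 * _]mulrC.
Qed.

Lemma psdmx_conj_diag (U : 'M[Cx R]_n) (d : 'rV[Cx R]_n) :
  U \is unitarymx -> (forall i, 0 <= d 0 i) ->
  psdmx (invmx U *m diag_mx d *m U).
Proof.
move=> Uu d0; rewrite invmx_unitary//; split; last first.
  move=> v; have -> : v ^t* *m (U ^t* *m diag_mx d *m U) *m v =
      (U *m v) ^t* *m diag_mx d *m (U *m v) by rewrite adjmxM !mulmxA.
  by rewrite form_diag sumr_ge0// => i _; rewrite mulr_ge0// exprn_ge0.
rewrite hermE !adjmxM trmxCK mulmxA tr_diag_mx map_diag_mx.
suff -> : d ^ Num.conj = d by [].
by apply/rowP => i; rewrite !mxE; apply/CrealP; rewrite ger0_real.
Qed.

Lemma psdmx_spectral A : psdmx A ->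
  A = invmx (spectralmx A) *m diag_mx (spectral_diag A) *m spectralmx A.
Proof. by case=> hA _; apply/orthomx_spectralP/hermitian_normalmx. Qed.

Lemma psdmx_spectral_ge0 A i : psdmx A -> 0 <= spectral_diag A 0 i.
Proof.
move=> pA; have [_ /(_ (invmx (spectralmx A) *m delta_mx i 0))] := pA.
have uS := spectral_unitarymx A.
rewrite {2}(psdmx_spectral pA).
set S := spectralmx A in uS *; set d := spectral_diag A.
pose e : 'cV[Cx R]_n := delta_mx i 0; rewrite -/e.
have -> : (invmx S *m e) ^t* *m (invmx S *m diag_mx d *m S) *m (invmx S *m e)
    = e ^t* *m diag_mx d *m e.
  have Su := unitarymx_unit uS.
  rewrite adjmxM invmx_unitary// trmxCK -invmx_unitary// !mulmxA.
  by rewrite !mulmxK// -mulmxA mulKVmx.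
rewrite form_diag (bigD1 i)//= big1 => [|j ji].
  by rewrite mxE !eqxx normr1 expr1n mulr1 addr0.
by rewrite mxE (negPf ji) normr0 expr0n mulr0.
Qed.

Lemma psdmx_gram A : psdmx (A ^t* *m A).
Proof.
split; first by rewrite hermE adjmxM trmxCK.
move=> v; rewrite mulmxA -adjmxM -mulmxA mxE sumr_ge0// => i _.
by rewrite !mxE mulrC -normCK exprn_ge0.
Qed.

Lemma sqrtmxP A : psdmx A -> psdmx (sqrtmx A) /\ sqrtmx A *m sqrtmx A = A.
Proof.
move=> pA; split.
  apply: psdmx_conj_diag; first exact: spectral_unitarymx.
  by move=> i; rewrite mxE sqrtC_ge0 psdmx_spectral_ge0.
rewrite [RHS]psdmx_spectral// /sqrtmx.
have Su := spectral_unit A.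
rewrite !mulmxA mulmxK// -(mulmxA (invmx _) (diag_mx _) (diag_mx _)) mulmx_diag.
by congr (_ *m diag_mx _ *m _); apply/rowP => i; rewrite !mxE -expr2 sqrtCK.
Qed.

Lemma sqrtmx_unique A B : psdmx A -> psdmx B -> B *m B = A -> B = sqrtmx A.
Proof.
move=> pA pB BBA.
have SA := psdmx_spectral pA; have SB := psdmx_spectral pB.
have Su := spectral_unit A; have Tu := spectral_unit B.
have b0 i := psdmx_spectral_ge0 i pB.
rewrite /sqrtmx; set S := spectralmx A in SA Su *.
set T := spectralmx B in SB Tu *.
set a := spectral_diag A in SA *; set b := spectral_diag B in SB b0 *.
pose W := S *m invmx T.
have E : diag_mx a *m W = W *m diag_mx b *m diag_mx b.
  have : S *m A *m invmx T = S *m (B *m B) *m invmx T by rewrite BBA.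
  rewrite {1}SA {1 2}SB /W !mulmxA mulmxV// mul1mx.
  by rewrite !mulmxK// => ->.
have F : diag_mx (map_mx sqrtC a) *m W = W *m diag_mx b.
  clearbody W; apply/matrixP => i j; move/matrixP: E => /(_ i j).
  rewrite !mul_diag_mx !mul_mx_diag !mxE.
  have [-> _|W0] := eqVneq (W i j) 0; first by rewrite mul0r mulr0.
  rewrite -mulrA -expr2 mulrC => /(mulfI W0) ->.
  by rewrite mulrC exprCK.
have -> : invmx S *m diag_mx (map_mx sqrtC a) *m S =
    invmx S *m (diag_mx (map_mx sqrtC a) *m W) *m T.
  by rewrite /W !mulmxA mulmxKV.
by rewrite F /W !mulmxA mulVmx// mul1mx.
Qed.

Lemma trnormE A : toCx (trnorm A) = \tr (sqrtmx (A ^t* *m A)).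
Proof.
apply: RRe_real; apply: ger0_real; rewrite /sqrtmx mxtrace_mulC mulKVmx.
  rewrite mxtrace_diag sumr_ge0// => i _.
  by rewrite mxE sqrtC_ge0; apply/psdmx_spectral_ge0/psdmx_gram.
exact: spectral_unit.
Qed.

End facts.

(* Main.v *)
(** A bound [trnorm (rho0 - rho1) >= d] on [A0 x A1] says that writing
    [P - Q = t (rho0 - rho1)] with [P], [Q] positive semidefinite costs
    [tr P + tr Q >= t d].  Together with a Hermitian perturbation [X], this
    makes the pairs [(X, x)] such that [P - Q = X + t (rho0 - rho1)] and
    [x = tr P + tr Q - t d] a convex cone lying above 0 over [X = 0], so a
    Hahn-Banach argument in finite dimension gives a linear form below it,
    [X |-> tr (X H)] with [H] Hermitian.  Taking [t = 0] yields [- 1 <= H <= 1],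
    taking [P = Q = 0] yields [tr ((rho0 - rho1) H) >= d], and the measurement
    is [E0 = (1 + H) / 2], [E1 = (1 - H) / 2]. *)

Require Import Defs.
From HB Require Import structures.
From mathcomp Require Import all_boot all_order all_algebra.
From mathcomp Require Import sesquilinear spectral complex.
From mathcomp Require Import all_classical all_reals all_analysis.
From mathcomp Require Import ring lra.
Import Order.TTheory GRing.Theory Num.Theory.
Import numFieldNormedType.Exports.
Local Open Scope classical_set_scope.
Local Open Scope ring_scope.

(** * Hahn-Banach for convex cones in finite dimension *)

Section cone_separation.
Set Implicit Arguments.
Unset Strict Implicit.
Variables (R : realType) (V : lmodType R) (S : V -> R -> Prop).
Hypothesis SD : forall v w x y, S v x -> S w y -> S (v + w) (x + y).
Hypothesis SZ : forall (t : R) v x, 0 < t -> S v x -> S (t *: v) (t * x).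
Hypothesis S_total : forall v, exists x, S v x.
Hypothesis S0 : forall x, S 0 x -> 0 <= x.

(* Hahn-Banach one vector at a time, with the epigraph of the sublinear
   functional replaced by a cone S. *)
Lemma cone_minorant_span (e : nat -> V) (m : nat) : exists c : nat -> R,
  forall (a : nat -> R) x,
    S (\sum_(i < m) a i *: e i) x -> \sum_(i < m) a i * c i <= x.
Proof.
elim: m => [|m [c IH]].
  by exists (fun=> 0) => a x; rewrite !big_ord0; apply: S0.
pose y (a : nat -> R) := \sum_(i < m) a i *: e i.
pose phi (a : nat -> R) := \sum_(i < m) a i * c i.
have yD a b : y (fun i => a i + b i) = y a + y b.
  by rewrite -big_split; apply: eq_bigr => i _; rewrite scalerDl.
have phiD a b : phi (fun i => a i + b i) = phi a + phi b.
  by rewrite -big_split; apply: eq_bigr => i _; rewrite mulrDl.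
have yZ t a : y (fun i => t * a i) = t *: y a.
  by rewrite scaler_sumr; apply: eq_bigr => i _; rewrite scalerA.
have phiZ t a : phi (fun i => t * a i) = t * phi a.
  by rewrite mulr_sumr; apply: eq_bigr => i _; rewrite mulrA.
(* The value at [e m] has to lie above every element of [L] and below every [z - phi b] with
   [S (y b + e m) z]. [key] orders the two families by adding the cone elements, which cancels
   [e m]; [S_total] makes both nonempty, so [sup L] fits. *)
pose L := [set r | exists a x, S (y a - e m) x /\ r = phi a - x].
have key a x b z : S (y a - e m) x -> S (y b + e m) z -> phi a - x <= z - phi b.
  move=> Sa Sb; have := SD Sa Sb; rewrite addrACA addNr addr0 -yD.
  by move=> /(IH (fun i => a i + b i)); move: (phiD a b); rewrite /phi; lra.
have y0 : y (fun=> 0) = 0 by apply: big1 => i _; rewrite scale0r.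
have L0 : L !=set0.
  have [x Sx] := S_total (- e m).
  by exists (phi (fun=> 0) - x), (fun=> 0), x; rewrite y0 add0r.
have Lub b z : S (y b + e m) z -> ubound L (z - phi b).
  by move=> Sb _ [a [x [Sa ->]]]; exact: key.
have LS : has_sup L.
  split=> //; have [z Sz] := S_total (e m).
  by exists (z - phi (fun=> 0)); apply: Lub; rewrite y0 add0r.
exists (fun i => if i == m then sup L else c i) => a x.
rewrite !big_ord_recr /= eqxx.
rewrite (eq_bigr (fun i : 'I_m => a i * c i)); last first.
  by move=> i _; rewrite ltn_eqF.
rewrite -/(y a) -/(phi a).
(* Scaling by the inverse of the absolute value of [a m] makes the coefficient of [e m] equal to 1,
   where [Lub] applies, or -1, which yields an element of [L]. *)
have [am|am|->] := ltgtP (a m) 0; last first.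
- by rewrite scale0r mul0r !addr0; apply: IH.
- move=> Sx; have ia : 0 < (a m)^-1 by rewrite invr_gt0.
  have := SZ ia Sx; rewrite scalerDr -yZ scalerA mulVf ?gt_eqF// scale1r.
  move=> /Lub /(ge_sup L0); rewrite phiZ -mulrBr.
  rewrite -(ler_pM2l am) mulrA divff ?gt_eqF// mul1r; lra.
- move=> Sx; have na : 0 < - a m by rewrite oppr_gt0.
  have ia : 0 < (- a m)^-1 by rewrite invr_gt0.
  have := SZ ia Sx; rewrite scalerDr -yZ scalerA.
  rewrite -[X in _ * X]opprK mulrN mulVf ?gt_eqF// scaleN1r => Sy.
  have /(ub_le_sup LS.2) : L (phi (fun i => (- a m)^-1 * a i) - (- a m)^-1 * x).
    by do 2 eexists; split; [exact: Sy|].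
  rewrite phiZ -mulrBr -(ler_pM2l na) mulrA divff ?gt_eqF// mul1r; lra.
Qed.

End cone_separation.

(** On a basis, coordinates turn the coefficients [c] into a linear form. *)
Lemma cone_minorant (R : realType) (V : vectType R) (S : V -> R -> Prop) :
  (forall v w x y, S v x -> S w y -> S (v + w) (x + y)) ->
  (forall (t : R) v x, 0 < t -> S v x -> S (t *: v) (t * x)) ->
  (forall v, exists x, S v x) ->
  (forall x, S 0 x -> 0 <= x) ->
  exists f : {linear V -> R^o}, forall v x, S v x -> f v <= x.
Proof.
move=> SD SZ St S0; pose X := vbasis (@fullv R V).
have [c cP] := cone_minorant_span SD SZ St S0 (nth 0 X) (\dim (@fullv R V)).
have fX (v : V) : v = \sum_i coord X i v *: X`_i.
  by rewrite -coord_vbasis ?memvf.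
pose f (v : V) : R^o := \sum_i coord X i v * c i.
have fl : linear f.
  move=> t v w; rewrite /f scaler_sumr -big_split; apply: eq_bigr => i _ /=.
  by rewrite linearP mulrDl -mulrA.
pose F : {linear V -> R^o} := HB.pack f (GRing.isLinear.Build _ _ _ _ _ fl).
exists F => v x Sv.
(* The default 0 lies beyond the dimension and never enters the sum. *)
pose a i := if insub i is Some j then coord X j v else 0.
have aE (i : 'I_(\dim (@fullv R V))) : a i = coord X i v by rewrite /a valK.
have := cP a x; under eq_bigr do rewrite aE.
rewrite -fX => /(_ Sv); by under eq_bigr do rewrite aE.
Qed.

HB.instance Definition _ (R : realType) :=
  GRing.RMorphism.copy (@toCx R) (real_complex R).

(** Transposition and cyclicity pair up the four terms: [\tr (A *m C)] gets the coefficient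
    [u * u + v * v], and [\tr (A *m C^T)] gets [u * v + u * v]. *)
Lemma mxtrace_mul_skew (F : comNzRingType) (n : nat) (u v : F) (A C : 'M[F]_n) :
  u * u + v * v = 0 -> u * v + u * v = 1 ->
  \tr ((u *: A + v *: A^T) *m (u *: C + v *: C^T)) = \tr (A *m C^T).
Proof.
move=> uu uv.
rewrite mulmxDr !mulmxDl -!scalemxAr -!scalemxAl !mxtraceD !mxtraceZ.
rewrite -(mxtrace_tr (A^T *m C)) trmx_mul trmxK (mxtrace_mulC C^T A).
rewrite -(mxtrace_tr (A^T *m C^T)) trmx_mul !trmxK (mxtrace_mulC C A).
move: (\tr (A *m C)) (\tr (A *m C^T)) => x y.
transitivity ((u * u + v * v) * x + (u * v + u * v) * y); first by ring.
by rewrite uu uv; ring.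
Qed.

(** * Positive semidefinite matrices, the trace norm, and real coordinates on Hermitian matrices *)

Section matrices.
Set Implicit Arguments.
Unset Strict Implicit.
Local Open Scope sesquilinear_scope.
Variables (R : realType) (n : nat).
Implicit Types (A B P Q X : 'M[Cx R]_n) (a c : 'M[R]_n).

Lemma toCx_le (x y : R) : (toCx x <= toCx y) = (x <= y).
Proof. exact: lecR. Qed.

Lemma conj_toCx (x : R) : (toCx x)^* = toCx x.
Proof. exact: conjc_real. Qed.

Lemma toCx_real (z : Cx R) : z \is Num.real -> z = toCx (complex.Re z).
Proof. by move=> ?; rewrite /toCx RRe_real. Qed.

Lemma adjmxZ (k : Cx R) A : (k *: A) ^t* = k^* *: A ^t*.
Proof. by rewrite linearZ /= map_mxZ. Qed.

Lemma adjmxD A B : (A + B) ^t* = A ^t* + B ^t*.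
Proof. by rewrite linearD /= map_mxD. Qed.

Lemma psdmxD P Q : psdmx P -> psdmx Q -> psdmx (P + Q).
Proof.
move=> [/[!hermE]/eqP hP pP] [/[!hermE]/eqP hQ pQ]; split.
  by rewrite hermE adjmxD -hP -hQ.
by move=> v; rewrite mulmxDr mulmxDl mxE addr_ge0.
Qed.

Lemma psdmxZ (k : Cx R) P : 0 <= k -> psdmx P -> psdmx (k *: P).
Proof.
move=> k0 [/[!hermE]/eqP hP pP]; split.
  by rewrite hermE adjmxZ -hP (CrealP (ger0_real k0)).
by move=> v; rewrite -scalemxAr -scalemxAl mxE mulr_ge0.
Qed.

Lemma psdmx0 : psdmx (0 : 'M[Cx R]_n).
Proof.
split=> [|v]; first by rewrite hermE linear0 map_mx0.
by rewrite mulmx0 mul0mx mxE.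
Qed.

Lemma psdmx1 : psdmx (1%:M : 'M[Cx R]_n).
Proof.
have -> : 1%:M = 1%:M ^t* *m 1%:M :> 'M[Cx R]_n.
  by rewrite mulmx1 trmx1 map_mx1.
exact: psdmx_gram.
Qed.

Lemma psdmx_outer (v : 'cV[Cx R]_n) : psdmx (v *m v ^t*).
Proof.
split; first by rewrite hermE adjmxM trmxCK.
move=> w; rewrite mulmxA -mulmxA mxE big_ord1.
have -> : (w ^t* *m v) 0 0 = ((v ^t* *m w) 0 0)^*.
  by rewrite -[w ^t* *m v]trmxCK adjmxM trmxCK !mxE.
by rewrite mulrC -normCK exprn_ge0.
Qed.

Lemma psdmx_diag_ge0 P i : psdmx P -> 0 <= P i i.
Proof.
case=> _ /(_ (delta_mx i 0)).
rewrite trmx_delta map_delta_mx -rowE mxE (bigD1 i)//= big1 => [|j ji].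
  by rewrite !mxE !eqxx mulr1 addr0.
by rewrite !mxE (negPf ji) mulr0.
Qed.

Lemma psdmx_tr_ge0 P : psdmx P -> 0 <= \tr P.
Proof. by move=> pP; apply: sumr_ge0 => i _; apply: psdmx_diag_ge0. Qed.

Lemma psdmx_conj (U P : 'M[Cx R]_n) : psdmx P -> psdmx (U *m P *m U ^t*).
Proof.
move=> [/[!hermE]/eqP hP pP]; split.
  by rewrite hermE !adjmxM trmxCK -hP mulmxA.
move=> v; have -> : v ^t* *m (U *m P *m U ^t*) *m v =
  (U ^t* *m v) ^t* *m P *m (U ^t* *m v) by rewrite adjmxM trmxCK !mulmxA.
exact: pP.
Qed.

(** Replacing [d] by its absolute values gives a positive semidefinite square root of [X ^t* *m X],
    hence the square root by [sqrtmx_unique]. *)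
Lemma trnorm_conj_diag (U : 'M[Cx R]_n) (d : 'rV[Cx R]_n) :
  U \is unitarymx -> (forall i, d 0 i \is Num.real) ->
  toCx (trnorm (invmx U *m diag_mx d *m U)) = \sum_i `|d 0 i|.
Proof.
move=> uU dR; have Uu := unitarymx_unit uU; rewrite trnormE.
have sq (c : 'rV[Cx R]_n) :
    invmx U *m diag_mx c *m U *m (invmx U *m diag_mx c *m U)
    = invmx U *m (diag_mx c *m diag_mx c) *m U.
  by rewrite !mulmxA mulmxK.
set X := invmx U *m diag_mx d *m U.
have -> : X ^t* = X.
  rewrite /X invmx_unitary// !adjmxM trmxCK mulmxA tr_diag_mx map_diag_mx.
  congr (_ *m diag_mx _ *m _); apply/rowP => i; rewrite mxE.
  exact/CrealP.
rewrite -(@sqrtmx_unique _ _ _ (invmx U *m diag_mx (map_mx Num.norm d) *m U)).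
- rewrite mxtrace_mulC mulKVmx// mxtrace_diag.
  by apply: eq_bigr => i _; rewrite mxE.
- have -> : X *m X = invmx U *m diag_mx (\row_i (d 0 i * d 0 i)) *m U.
    by rewrite sq mulmx_diag.
  by apply: psdmx_conj_diag => // i; rewrite mxE -expr2 real_exprn_even_ge0.
- by apply: psdmx_conj_diag => // i; rewrite mxE.
apply: etrans (sq _) _; apply: etrans (esym (sq _)).
suff -> : diag_mx (map_mx Num.norm d) *m diag_mx (map_mx Num.norm d)
  = diag_mx d *m diag_mx d by [].
rewrite !mulmx_diag; congr diag_mx; apply/rowP => i.
by rewrite !mxE -!expr2 real_normK.
Qed.

(** In an orthonormal eigenbasis of [P - Q], each eigenvalue is the difference of the diagonal
    entries of [P] and [Q]. These are nonnegative, so its absolute value is at most their sum, and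
    the sums add up to the traces. *)
Lemma trnorm_le_sub P Q : psdmx P -> psdmx Q ->
  toCx (trnorm (P - Q)) <= \tr P + \tr Q.
Proof.
move=> pP pQ.
have hX : P - Q \is hermsymmx.
  move: pP.1 pQ.1; rewrite !hermE => /eqP hP /eqP hQ.
  by rewrite linearB /= map_mxB -hP -hQ.
have [U [d [uU dR XE]]] : exists (U : 'M[Cx R]_n) (d : 'rV[Cx R]_n),
    [/\ U \is unitarymx, forall i, d 0 i \is Num.real
      & P - Q = invmx U *m diag_mx d *m U].
  exists (spectralmx (P - Q)), (spectral_diag (P - Q)); split.
  - exact: spectral_unitarymx.
  - by move: hX => /hermitian_spectral_diag_real/mxOverP h i; apply: h.
  - exact/orthomx_spectralP/hermitian_normalmx.
have Uu := unitarymx_unit uU.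
rewrite {1}XE trnorm_conj_diag//.
have trU Z : \tr Z = \sum_i (U *m Z *m U ^t*) i i.
  by rewrite -/(\tr _) mxtrace_mulC mulmxA -invmx_unitary// mulVmx// mul1mx.
rewrite !trU -big_split; apply: ler_sum => i _ /=.
have -> : d 0 i = (U *m P *m U ^t*) i i - (U *m Q *m U ^t*) i i.
  transitivity ((U *m (P - Q) *m U ^t*) i i).
    rewrite XE -invmx_unitary// !mulmxA mulmxV// mul1mx mulmxK// mxE.
    by rewrite eqxx.
  by rewrite mulmxBr mulmxBl !mxE.
apply: le_trans (ler_normB _ _) _.
by rewrite !ger0_norm//; apply/psdmx_diag_ge0/psdmx_conj.
Qed.

Lemma trnorm_ge0 A : 0 <= trnorm A.
Proof.
rewrite -toCx_le rmorph0 trnormE.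
exact/psdmx_tr_ge0/(sqrtmxP (psdmx_gram A)).1.
Qed.

(* X = ((X + 1)^2 - (X - 1)^2) / 4 *)
Lemma herm_psdmx_sub X : X \is hermsymmx ->
  exists P Q, [/\ psdmx P, psdmx Q & X = P - Q].
Proof.
rewrite hermE => /eqP hX.
have h1 (k : Cx R) : k^* = k -> (X + k%:M) ^t* = X + k%:M.
  by move=> kk; rewrite adjmxD -hX tr_scalar_mx map_scalar_mx /= kk.
have psq (k : Cx R) : k^* = k -> psdmx (4^-1 *: ((X + k%:M) *m (X + k%:M))).
  move=> kk; apply: psdmxZ; first by rewrite invr_ge0.
  by rewrite -{1}h1//; apply: psdmx_gram.
exists (4^-1 *: ((X + 1%:M) *m (X + 1%:M))),
  (4^-1 *: ((X + (-1)%:M) *m (X + (-1)%:M))); split.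
- by apply: psq; rewrite rmorph1.
- by apply: psq; rewrite rmorphN rmorph1.
rewrite -scalerBr !mulmxDr !mulmxDl !mul_mx_scalar !mul_scalar_mx.
move: (X *m X) => Y; apply: (@scalerI _ _ (4 : Cx R)); first by rewrite pnatr_eq0.
rewrite scalerA divff ?pnatr_eq0// scale1r.
by apply/matrixP => i j; rewrite !mxE; case: (i == j); rewrite ?mulr1n ?mulr0n; ring.
Qed.

(* The real linear bijection a |-> (a + a^T) / 2 + 'i (a - a^T) / 2 from real
   matrices onto Hermitian ones; it is an isometry (hermmx_of_tr), which lets
   the separation take place in the real vector space 'M[R]_n. *)
Definition hermmx_of a : 'M[Cx R]_n :=
  ((1 + 'i) / 2) *: map_mx (@toCx R) a
  + ((1 - 'i) / 2) *: (map_mx (@toCx R) a)^T.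

Lemma half_addi_conj : ((1 + 'i) / 2 : Cx R)^* = (1 - 'i) / 2.
Proof. by rewrite rmorphM rmorphD fmorphV rmorph1 rmorph_nat /= conjCi. Qed.

Lemma half_subi_conj : ((1 - 'i) / 2 : Cx R)^* = (1 + 'i) / 2.
Proof. by rewrite -half_addi_conj conjCK. Qed.

Lemma hermmx_of_herm a : hermmx_of a \is hermsymmx.
Proof.
have conjZ (z : Cx R) (x : R) : (z * toCx x)^* = z^* * toCx x.
  by rewrite rmorphM /= conj_toCx.
rewrite hermE; apply/eqP/matrixP => i j; rewrite !mxE rmorphD /= !conjZ.
by rewrite half_addi_conj half_subi_conj addrC.
Qed.

Lemma hermmx_ofD a c : hermmx_of (a + c) = hermmx_of a + hermmx_of c.
Proof.
by apply/matrixP => i j; rewrite !mxE rmorphD rmorphD !mulrDr addrACA.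
Qed.

Lemma hermmx_ofZ (t : R) a : hermmx_of (t *: a) = toCx t *: hermmx_of a.
Proof.
by apply/matrixP => i j; rewrite !mxE rmorphM rmorphM mulrDr !(mulrCA (toCx t)).
Qed.

Lemma hermmx_ofP X : X \is hermsymmx -> exists a, X = hermmx_of a.
Proof.
rewrite hermE => /eqP hX.
(* For Hermitian [X] the real part is symmetric and the imaginary part antisymmetric, so they are
   the symmetric and antisymmetric parts of this matrix. *)
exists (\matrix_(i, j) (complex.Re (X i j) + complex.Im (X i j))).
apply/matrixP => i j; rewrite !mxE.
have -> : X j i = (X i j)^* by rewrite {2}hX !mxE conjCK.
have XE : X i j = toCx (complex.Re (X i j)) + 'i * toCx (complex.Im (X i j)).
  by rewrite {1}[X i j]complexE complexiE.
have -> : complex.Re (X i j)^* = complex.Re (X i j) by case: (X i j).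
have -> : complex.Im (X i j)^* = - complex.Im (X i j) by case: (X i j).
rewrite {1}XE !rmorphD rmorphN /=.
move: (toCx _) (toCx _) => x y.
have E (F : numFieldType) (k s t : F) : s + k * t =
  (1 + k) / 2 * (s + t) + (1 - k) / 2 * (s - t) by field.
exact: E.
Qed.

Lemma hermmx_of_tr a c :
  \tr (hermmx_of a *m hermmx_of c) = toCx (\sum_i \sum_j a i j * c i j).
Proof.
transitivity (\tr (map_mx (@toCx R) a *m (map_mx (@toCx R) c)^T)); last first.
  rewrite rmorph_sum; apply: eq_bigr => i _; rewrite mxE rmorph_sum.
  by apply: eq_bigr => j _; rewrite !mxE rmorphM.
have i2 : 'i * 'i = -1 :> Cx R by rewrite -expr2 sqrCi.
(* The coefficients [(1 + k) / 2] and [(1 - k) / 2] have opposite squares [k / 2] and [- k / 2], and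
   product 1/2. *)
have E (F : numFieldType) (k : F) : k * k = - 1 ->
  let u := (1 + k) / 2 in let v := (1 - k) / 2 in
  u * u + v * v = 0 /\ u * v + u * v = 1.
  move=> kk; split.
    by transitivity ((1 + k * k) / 2); [field | rewrite kk addrN mul0r].
  by transitivity ((1 - k * k) / 2); [field | rewrite kk; field].
have [uu uv] := E _ _ i2.
exact: mxtrace_mul_skew.
Qed.

(** Self-duality of the positive semidefinite cone: the rank-one tests [v *m v ^t*] recover the
    quadratic form of [X]. *)
Lemma psdmx_trace_mul_ge0 X :
  X \is hermsymmx -> (forall P, psdmx P -> 0 <= \tr (P *m X)) -> psdmx X.
Proof.
move=> hX XP; split=> // v; rewrite -trace_mx11 -mulmxA mxtrace_mulC.
by rewrite -mulmxA mxtrace_mulC; apply/XP/psdmx_outer.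
Qed.

End matrices.

(** * The cone generated by a convex set *)

Section cone.
Set Implicit Arguments.
Unset Strict Implicit.
Variables (K : numFieldType) (V : lmodType K).
Implicit Types (A : set V) (v w : V).

Definition cone A : set V :=
  [set v | exists k x, [/\ 0 <= k, A x & v = k *: x]].

Lemma cone0 A : A !=set0 -> cone A 0.
Proof. by move=> [x Ax]; exists 0, x; rewrite scale0r. Qed.

Lemma coneZ A (k : K) v : 0 <= k -> cone A v -> cone A (k *: v).
Proof.
move=> k0 [l [x [l0 Ax ->]]]; exists (k * l), x.
by rewrite mulr_ge0// scalerA.
Qed.

(** The sum is [k + l] times the convex combination of [x] and [y] with weight [k / (k + l)]; if
    [k + l = 0], both terms vanish. *)
Lemma coneD A v w : convex_set A -> cone A v -> cone A w -> cone A (v + w).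
Proof.
move=> cA [k [x [k0 Ax ->]]] [l [y [l0 Ay ->]]].
have [kl0|kl0] := eqVneq (k + l) 0.
  move/eqP: kl0; rewrite paddr_eq0// => /andP[/eqP -> /eqP ->].
  by exists 0, x; rewrite !scale0r addr0.
have kl : 0 < k + l by rewrite lt_neqAle eq_sym kl0 addr_ge0.
have p0 : 0 <= k / (k + l) by rewrite divr_ge0// ltW.
have p1 : k / (k + l) <= 1 by rewrite ler_pdivrMr// mul1r lerDl.
have := cA x y (Itv01 p0 p1); rewrite !inE => /(_ Ax Ay) Axy.
have Ap : A ((k / (k + l)) *: x + (1 - k / (k + l)) *: y) by exact: Axy.
exists (k + l), ((k / (k + l)) *: x + (1 - k / (k + l)) *: y); split => //.
  exact: ltW.
rewrite scalerDr !scalerA mulrBr mulr1 (mulrC (k + l)) divfK//.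
by rewrite addrAC subrr add0r.
Qed.

End cone.

Lemma matrix_linear_form (R : realType) (n : nat) (f : {linear 'M[R]_n -> R^o}) :
  exists c : 'M[R]_n, forall a, f a = \sum_i \sum_j a i j * c i j.
Proof.
exists (\matrix_(i, j) f (delta_mx i j)) => a.
rewrite {1}[a]matrix_sum_delta linear_sum; apply: eq_bigr => i _.
rewrite linear_sum; apply: eq_bigr => j _.
by rewrite linearZ mxE.
Qed.

(** * The separating Hermitian matrix *)

Section separation.
Set Implicit Arguments.
Unset Strict Implicit.
Local Open Scope sesquilinear_scope.
Variables (R : realType) (n : nat) (A0 A1 : set 'M[Cx R]_n) (d : R).
Hypotheses (A0_density : A0 `<=` @density R n) (A1_density : A1 `<=` @density R n).
Hypotheses (A0_convex : convex_set A0) (A1_convex : convex_set A1).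
Hypotheses (A0_nonempty : A0 !=set0) (A1_nonempty : A1 !=set0).
Hypothesis d_le : forall rho0 rho1, A0 rho0 -> A1 rho1 -> d <= trnorm (rho0 - rho1).
Implicit Types (P Q X : 'M[Cx R]_n) (a : 'M[R]_n).

(* Since the elements of A0 and A1 have trace one, tr s0 = tr s1 =: t means
   s0 = t rho0 and s1 = t rho1 with the same t. *)
Definition gauge_rel a (x : R) : Prop :=
  exists P Q s0 s1,
  [/\ psdmx P, psdmx Q, cone A0 s0 & cone A1 s1] /\
  [/\ \tr s0 = \tr s1, P - Q = hermmx_of a + (s0 - s1)
    & toCx x = \tr P + \tr Q - toCx d * \tr s0].

Lemma gauge_relD a b x y :
  gauge_rel a x -> gauge_rel b y -> gauge_rel (a + b) (x + y).
Proof.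
move=> [P [Q [s0 [s1 [[pP pQ c0 c1] [t E xE]]]]]].
move=> [P' [Q' [s0' [s1' [[pP' pQ' c0' c1'] [t' E' yE]]]]]].
exists (P + P'), (Q + Q'), (s0 + s0'), (s1 + s1'); split; split.
- exact: psdmxD.
- exact: psdmxD.
- exact: coneD.
- exact: coneD.
- by rewrite !mxtraceD t t'.
- rewrite (opprD Q) (addrACA P) E E' hermmx_ofD (opprD s1) (addrACA s0).
  exact: addrACA.
- rewrite rmorphD /= xE yE !mxtraceD mulrDr.
  by rewrite opprD (addrACA (\tr P)); exact: addrACA.
Qed.

Lemma gauge_relZ (t : R) a x : 0 < t -> gauge_rel a x -> gauge_rel (t *: a) (t * x).
Proof.
move=> t0 [P [Q [s0 [s1 [[pP pQ c0 c1] [e E xE]]]]]].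
have t0' : 0 <= toCx t by rewrite -(rmorph0 (@toCx R)) toCx_le ltW.
exists (toCx t *: P), (toCx t *: Q), (toCx t *: s0), (toCx t *: s1); split; split.
- exact: psdmxZ.
- exact: psdmxZ.
- exact: coneZ.
- exact: coneZ.
- by rewrite !mxtraceZ e.
- by rewrite -!scalerBr E hermmx_ofZ scalerDr.
- by rewrite rmorphM /= xE !mxtraceZ mulrBr mulrDr (mulrCA (toCx d)).
Qed.

Lemma gauge_rel_total a : exists x, gauge_rel a x.
Proof.
have [P [Q [pP pQ E]]] := herm_psdmx_sub (hermmx_of_herm a).
exists (complex.Re (\tr P + \tr Q)), P, Q, 0, 0; split; split => //.
- exact: cone0.
- exact: cone0.
- by rewrite subrr addr0 E.
- rewrite mxtrace0 mulr0 subr0 -toCx_real// ger0_real// addr_ge0//;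
  exact: psdmx_tr_ge0.
Qed.

(** Equal traces force the same factor [k] in [s0] and [s1]. If [k] is positive, dividing by it
    writes [r0 - r1] as a difference of positive semidefinite matrices, so [trnorm_le_sub] and
    [d_le] bound [k * d] by [\tr P + \tr Q]. *)
Lemma gauge_rel0 x : gauge_rel 0 x -> 0 <= x.
Proof.
move=> [P [Q [s0 [s1 [[pP pQ [k [r0 [k0 A0r s0E]]] [l [r1 [l0 A1r s1E]]]] [e E xE]]]]]].
rewrite -toCx_le rmorph0 xE subr_ge0; move: e E.
rewrite s0E s1E !mxtraceZ (A0_density A0r).2 (A1_density A1r).2 !mulr1 => <-.
have -> : hermmx_of (0 : 'M[R]_n) = 0.
  by rewrite -(scale0r (0 : 'M[R]_n)) hermmx_ofZ rmorph0 scale0r.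
rewrite add0r -scalerBr => E.
have [->|kN0] := eqVneq k 0; first by rewrite mulr0 addr_ge0// psdmx_tr_ge0.
have kp : 0 < k by rewrite lt_neqAle eq_sym kN0.
have kV0 : 0 <= k^-1 by rewrite invr_ge0.
have := trnorm_le_sub (psdmxZ kV0 pP) (psdmxZ kV0 pQ).
rewrite -scalerBr E scalerA mulVf// scale1r !mxtraceZ -mulrDr.
rewrite mulrC ler_pdivlMr//; apply: le_trans.
by rewrite ler_pM2r// toCx_le d_le.
Qed.

Lemma exists_separating_hermmx : exists H : 'M[Cx R]_n,
  [/\ H \is hermsymmx,
      forall P, psdmx P -> \tr (P *m H) <= \tr P,
      forall P, psdmx P -> - \tr (P *m H) <= \tr P
    & forall rho0 rho1, A0 rho0 -> A1 rho1 ->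
        toCx d <= \tr (rho0 *m H) - \tr (rho1 *m H)].
Proof.
have [f fP] := cone_minorant gauge_relD gauge_relZ gauge_rel_total gauge_rel0.
have [c fE] := matrix_linear_form f.
(* The minorant inequality with the perturbation solved for: it is Hermitian, hence [hermmx_of a]
   for a real [a], and [hermmx_of_tr] turns [f a] into a trace against [hermmx_of c]. *)
have key P Q s0 s1 : psdmx P -> psdmx Q -> cone A0 s0 -> cone A1 s1 ->
    \tr s0 = \tr s1 -> P - Q - (s0 - s1) \is hermsymmx ->
    \tr s0 \is Num.real ->
    \tr ((P - Q - (s0 - s1)) *m hermmx_of c) <= \tr P + \tr Q - toCx d * \tr s0.
  move=> pP pQ c0 c1 e /hermmx_ofP[a aE] sR.
  pose y := complex.Re (\tr P + \tr Q - toCx d * \tr s0).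
  have yE : toCx y = \tr P + \tr Q - toCx d * \tr s0.
    rewrite -toCx_real// rpredB// ?rpredD// ?rpredM//.
    - exact/ger0_real/psdmx_tr_ge0.
    - exact/ger0_real/psdmx_tr_ge0.
    - by apply/CrealP; rewrite conj_toCx.
  rewrite aE hermmx_of_tr -fE -yE toCx_le; apply: fP.
  exists P, Q, s0, s1; split; split=> //.
  by rewrite -aE subrK.
have cA0 := cone0 A0_nonempty; have cA1 := cone0 A1_nonempty.
exists (hermmx_of c); split.
- exact: hermmx_of_herm.
- move=> P pP; have := key P 0 0 0 pP (psdmx0 R n) cA0 cA1 erefl.
  by rewrite !subr0 mxtrace0 mulr0 subr0 addr0 => -> //; rewrite ?pP.1.
- move=> P pP; have := key 0 P 0 0 (psdmx0 R n) pP cA0 cA1 erefl.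
  rewrite !subr0 sub0r mxtrace0 mulr0 subr0 add0r mulNmx raddfN /= => -> //.
  by move: pP.1; rewrite !hermE linearN /= map_mxN => /eqP <-.
move=> r0 r1 Ar0 Ar1.
have [[h0 _] t0] := A0_density Ar0; have [[h1 _] t1] := A1_density Ar1.
have c0 : cone A0 r0 by exists 1, r0; rewrite scale1r.
have c1 : cone A1 r1 by exists 1, r1; rewrite scale1r.
have hN : 0 - 0 - (r0 - r1) \is hermsymmx.
  move: h0 h1; rewrite !hermE !subrr sub0r opprB linearB /= map_mxB.
  by move=> /eqP <- /eqP <-.
(* The perturbation is [r1 - r0] and the bound is [- d], so both signs flip. *)
have := key 0 0 r0 r1 (psdmx0 R n) (psdmx0 R n) c0 c1 _ hN.
rewrite t0 t1 => /(_ erefl (rpred1 _)).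
rewrite subrr sub0r mxtrace0 addr0 sub0r mulr1 mulNmx raddfN /= lerN2.
by rewrite mulmxBl raddfB.
Qed.

End separation.

(** * The measurement built from the separating matrix *)

Theorem theorem3 (R : realType) (n : nat) (A0 A1 : set 'M[Cx R]_n)
  (A0_density : A0 `<=` @density R n) (A1_density : A1 `<=` @density R n)
  (A0_closed : closed A0) (A1_closed : closed A1)
  (A0_convex : convex_set A0) (A1_convex : convex_set A1) :
  exists E0 E1 : 'M[Cx R]_n,
    [/\ psdmx E0, psdmx E1, E0 + E1 = 1%:M
      & forall rho0 rho1 : 'M[Cx R]_n, A0 rho0 -> A1 rho1 ->
          2^-1 * \tr (E0 *m rho0) + 2^-1 * \tr (E1 *m rho1)
            >= 2^-1 + 4^-1 * toCx (trdist A0 A1)].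
Proof.
have [[A0N A1N]|empty] := pselect (A0 !=set0 /\ A1 !=set0); last first.
  (* With one of the sets empty there is no pair to test, so any measurement will do. *)
  exists 1%:M, 0; split; [exact: psdmx1|exact: psdmx0|by rewrite addr0|].
  by move=> r0 r1 Ar0 Ar1; case: empty; split; [exists r0|exists r1].
have d_le r0 r1 : A0 r0 -> A1 r1 -> trdist A0 A1 <= trnorm (r0 - r1).
  move=> Ar0 Ar1; apply: ge_inf; last by exists r0 => //; exists r1.
  by exists 0 => _ [? _ [? _ <-]]; exact: trnorm_ge0.
have [H [hH Hle HNle Hsep]] :=
  exists_separating_hermmx A0_density A1_density A0_convex A1_convex A0N A1N d_le.
have hE (k : Cx R) : k^* = k -> 2^-1 *: (1%:M + k *: H) \is hermsymmx.
  move: hH; rewrite !hermE => /eqP hH kR; apply/eqP.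
  rewrite adjmxZ adjmxD adjmxZ kR -hH trmx1 map_mx1.
  by rewrite fmorphV rmorph_nat.
have trE (P : 'M[Cx R]_n) (k : Cx R) : \tr (P *m (2^-1 *: (1%:M + k *: H)))
    = 2^-1 * (\tr P + k * \tr (P *m H)).
  by rewrite -scalemxAr mulmxDr mulmx1 -scalemxAr mxtraceZ mxtraceD mxtraceZ.
exists (2^-1 *: (1%:M + 1 *: H)), (2^-1 *: (1%:M + (-1) *: H)); split.
- apply: psdmx_trace_mul_ge0; first by apply: hE; rewrite rmorph1.
  move=> P pP; rewrite trE mul1r addrC -[\tr (P *m H)]opprK mulr_ge0 ?invr_ge0//.
  by rewrite addrC subr_ge0 HNle.
- apply: psdmx_trace_mul_ge0; first by apply: hE; rewrite rmorphN rmorph1.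
  by move=> P pP; rewrite trE mulN1r mulr_ge0 ?invr_ge0// subr_ge0 Hle.
- rewrite -scalerDr scale1r scaleN1r addrACA subrr addr0.
  have half2 : 2^-1 + 2^-1 = 1 :> Cx R by rewrite [RHS]splitr mul1r.
  by rewrite scalerDr -scalerDl half2 scale1r.
move=> r0 r1 Ar0 Ar1; have := Hsep _ _ Ar0 Ar1.
have T0 := etrans (mxtrace_mulC _ _) (trE r0 1).
have T1 := etrans (mxtrace_mulC _ _) (trE r1 (-1)).
rewrite T0 T1 (A0_density _ Ar0).2 (A1_density _ Ar1).2.
move: (toCx _) (\tr (r0 *m H)) (\tr (r1 *m H)) => d x y dle.
rewrite -subr_ge0.
(* The success probability exceeds the claimed bound by a quarter of the slack in [Hsep]. *)
have E (F : numFieldType) (s t u : F) : 2^-1 * (2^-1 * (1 + 1 * t)) +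
  2^-1 * (2^-1 * (1 + -1 * u)) - (2^-1 + 4^-1 * s) = 4^-1 * (t - u - s).
  by field.
by rewrite E mulr_ge0 ?invr_ge0// subr_ge0.
Qed.
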